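(* Let $n\ge1$, $\delta>0$ and $\beta=n$. Let $\mathbf b\in\mathcal H^S(\mathbf T^n)$ with $S>n$, and let $$\mathbf u(x,t)=\widehat{\mathbf b}_0\frac{t^2}{2}+\sum_{0\ne k\in\mathbb{Z}^n}\left[\cos(\sqrt{-M_k}\,t)-I\right]M_k^{-1}\widehat{\mathbf b}_ke^{ik\cdot x}$$ for $x\in\mathbf T^n$, $t\ge0$. Then $\mathbf u(x,\cdot)\in C^\infty[0,\infty)$ (in the classical sense) for any $x\in\mathbf T^n$.
   Context: Torus and spaces: $\mathbf T^n=\prod_{i=1}^n[0,2\pi]$ with periodic identification; a periodic vector distribution $\mathbf g$ is written $\mathbf g=\sum_{k\in\mathbb{Z}^n}\widehat{\mathbf g}_k e^{ik\cdot x}$ with Fourier coefficients $\widehat{\mathbf g}_k\in\mathbb{C}^n$. For $q\in\mathbb{R}$, $\mathcal H^q(\mathbf T^n)$ is the space of periodic vector distributions with $\|\mathbf g\|^2_{\mathcal H^q}=\sum_k(1+\|k\|^2)^q\|\widehat{\mathbf g}_k\|^2<\infty$. Multipliers: with ${}_pF_q(a_1,\dots,a_p;b_1,\dots,b_q;x)=\sum_{m\ge0}\frac{(a_1)_m\cdots(a_p)_m}{(b_1)_m\cdots(b_q)_m}\frac{x^m}{m!}$, where $(a)_m=a(a+1)\cdots(a+m-1)$, set for $\nu\in\mathbb{R}^n$ $$\lambda_1(\nu)=-\|\nu\|^2\Big(3\mu\,{}_3F_4\big(1,\tfrac52,\tfrac{n+2-\beta}{2};2,\tfrac32,\tfrac{n+4}{2},\tfrac{n+4-\beta}{2};-\tfrac14\|\nu\|^2\delta^2\big)+(\lambda^*-\mu)\,{}_1F_2\big(\tfrac{n+2-\beta}{2};\tfrac{n+2}{2},\tfrac{n+4-\beta}{2};-\tfrac14\|\nu\|^2\delta^2\big)^2\Big),$$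 $$\lambda_2(\nu)=-\mu\|\nu\|^2\,{}_2F_3\big(1,\tfrac{n+2-\beta}{2};2,\tfrac{n+4}{2},\tfrac{n+4-\beta}{2};-\tfrac14\|\nu\|^2\delta^2\big).$$ For $k\in\mathbb{Z}^n\setminus\{0\}$, $M_k$ is the real symmetric $n\times n$ matrix with $M_kk=\lambda_1(k)k$ and $M_kw=\lambda_2(k)w$ for $w\perp k$ (the Fourier multiplier of the linear state-based peridynamic operator). $\sqrt{-M_k}$ and $\cos(\sqrt{-M_k}t)$ are defined by functional calculus: same eigenvectors, with eigenvalues $\sqrt{-\lambda_i(k)}$ and $\cos(\sqrt{-\lambda_i(k)}t)$. $I$ is the identity matrix. Standing assumption: the Lamé parameters satisfy $\mu>0$ and $\lambda^*\in\mathbb{R}$ is such that $\lambda_1(\nu)<0$ for all $\nu\ne0$ (and $\lambda_2(\nu)<0$ for all $\nu\neq0$). *)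

(* Defs.v *)
From HB Require Import structures.
From mathcomp Require Import all_boot all_order all_algebra finmap.
From mathcomp Require Import all_classical all_reals all_analysis.
From mathcomp Require Import summability complex.

Set Implicit Arguments.
Unset Strict Implicit.
Unset Printing Implicit Defensive.

Import Order.TTheory GRing.Theory Num.Theory.
Import numFieldNormedType.Exports.

Local Open Scope classical_set_scope.
Local Open Scope ring_scope.
Local Open Scope complex_scope.

(* The complex numbers with their norm topology: the topological structures   *)
(* are attached to the regular module R[i]^o, not to R[i] itself.             *)
Notation Cplx R := ((R[i])^o).

Section Hypergeometric.
Variable R : realType.

Definition pochhammer (a : R) (m : nat) : R := \prod_(i < m) (a + i%:R).

Definition pFq (a b : seq R) (x : R) : R :=
  limn (series (fun m : nat =>
    (\prod_(c <- a) pochhammer c m) / (\prod_(c <- b) pochhammer c m)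
    * (x ^+ m / m`!%:R))).

End Hypergeometric.

Section Vectors.
Variables (R : realType) (n : nat).

(* The norm that the library puts on column vectors is the sup norm; the      *)
(* squared Euclidean norms are therefore spelled out.                         *)
Definition sqnorm (v : 'cV[R]_n) : R := \sum_i v i 0 ^+ 2.

Definition csqnorm (z : 'cV[Cplx R]_n) : R :=
  \sum_i (complex.Re (z i 0) ^+ 2 + complex.Im (z i 0) ^+ 2).

Definition dotp (v w : 'cV[R]_n) : R := \sum_i v i 0 * w i 0.

Definition real_vec (k : 'cV[int]_n) : 'cV[R]_n := map_mx intr k.

Definition torus : set 'cV[R]_n :=
  [set x | forall i, 0 <= x i 0 <= 2 * pi].

Definition cis (theta : R) : Cplx R := cos theta +i* sin theta.

(* The symmetric matrix with eigenvalue a on the line spanned by v and        *)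
(* eigenvalue b on its orthogonal complement (v != 0).                        *)
Definition eig_mx (v : 'cV[R]_n) (a b : R) : 'M[R]_n :=
  let P := (sqnorm v)^-1 *: (v *m v^T) in a *: P + b *: (1%:M - P).

Lemma eig_mx_mul (v : 'cV[R]_n) (a b : R) (w : 'cV[R]_n) :
  let p := (sqnorm v)^-1 * dotp v w in
  eig_mx v a b *m w = (a * p) *: v + b *: (w - p *: v).
Proof.
rewrite /eig_mx mulmxDl -!scalemxAl mulmxBl mul1mx -!scalemxAl -mulmxA.
have -> : v^T *m w = (dotp v w)%:M.
  apply/matrixP => i j; rewrite !mxE !ord1 eqxx mulr1n.
  by apply: eq_bigr => l _; rewrite !mxE.
by rewrite mul_mx_scalar !scalerA !mulrA.
Qed.

Lemma dotpvv (v : 'cV[R]_n) : dotp v v = sqnorm v.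
Proof. by apply: eq_bigr => i _; rewrite expr2. Qed.

Lemma sqnorm_eq0 (v : 'cV[R]_n) : (sqnorm v == 0) = (v == 0).
Proof.
have sq0 i : true -> 0 <= v i 0 ^+ 2 by move=> _; exact: sqr_ge0.
rewrite /sqnorm (psumr_eq0 _ sq0).
apply/allP/eqP => [v0|-> i _]; last by rewrite mxE expr0n /= eqxx.
apply/matrixP => i j; rewrite ord1 mxE.
by apply/eqP; rewrite -sqrf_eq0; apply: (implyP (v0 i _)) => //; rewrite mem_index_enum.
Qed.

Lemma eig_mx_sym (v : 'cV[R]_n) (a b : R) : (eig_mx v a b)^T = eig_mx v a b.
Proof.
apply/matrixP => i j; rewrite !mxE !big_ord1 !mxE.
by rewrite (eq_sym j i) [v j 0 * _]mulrC.
Qed.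

Lemma eig_mxP (v : 'cV[R]_n) (a b : R) (A : 'M[R]_n) : v != 0 ->
  A = eig_mx v a b <->
  A *m v = a *: v /\ (forall w, dotp v w = 0 -> A *m w = b *: w).
Proof.
move=> v0; have sv : sqnorm v != 0 by rewrite sqnorm_eq0.
split=> [->|[Av Aw]].
  split=> [|w vw]; rewrite eig_mx_mul.
    by rewrite dotpvv mulVf // mulr1 scale1r subrr scaler0 addr0.
  by rewrite vw !mulr0 !scale0r add0r subr0.
suff AE (w : 'cV[R]_n) : A *m w = eig_mx v a b *m w.
  apply/matrixP => i j.
  have /matrixP/(_ i 0) := AE (delta_mx j 0).
  by rewrite -!colE !mxE.
rewrite eig_mx_mul; set p := _^-1 * _.
have vq : dotp v (w - p *: v) = 0.
  rewrite /dotp; under eq_bigr do rewrite !mxE mulrBr mulrCA.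
  rewrite sumrB -mulr_sumr -/(dotp v w) -/(dotp v v) dotpvv.
  by rewrite /p mulrAC mulVf // mul1r subrr.
rewrite -[in LHS](subrK (p *: v) w) mulmxDr -scalemxAr Av (Aw _ vq).
by rewrite addrC scalerA [p * a]mulrC.
Qed.

(* The functional calculus on these matrices: f maps the eigenvalue c of an   *)
(* eigenvector w to the eigenvalue f c of the same eigenvector.               *)
Lemma eig_mx_fun (f : R -> R) (v w : 'cV[R]_n) (a b c : R) : v != 0 ->
  eig_mx v a b *m w = c *: w -> eig_mx v (f a) (f b) *m w = f c *: w.
Proof.
move=> v0; have sv : sqnorm v != 0 by rewrite sqnorm_eq0.
rewrite !eig_mx_mul; set p := _^-1 * _; set q := w - p *: v => cw.
have wE : w = p *: v + q by rewrite /q addrC subrK.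
have vq : dotp v q = 0.
  rewrite /dotp /q; under eq_bigr do rewrite !mxE mulrBr mulrCA.
  rewrite sumrB -mulr_sumr -/(dotp v w) -/(dotp v v) dotpvv.
  by rewrite /p mulrAC mulVf // mul1r subrr.
clearbody q; have key : ((a - c) * p) *: v + (b - c) *: q = 0.
  rewrite mulrBl scalerBl [(b - c) *: q]scalerBl addrACA -opprD -scalerA.
  by rewrite -[(c * p) *: v]scalerA -scalerDr -wE scalerA cw subrr.
have dD (x y : R) : dotp v (x *: v + y *: q) = x * sqnorm v + y * dotp v q.
  rewrite -dotpvv /dotp !mulr_sumr -big_split; apply: eq_bigr => i _ /=.
  by rewrite !mxE mulrDr !(mulrCA (v i 0)).
have acp : (a - c) * p = 0.
  have := dD ((a - c) * p) (b - c).
  rewrite key vq mulr0 addr0 /dotp big1 => [/esym/eqP|i _]; last first.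
    by rewrite mxE mulr0.
  by rewrite mulf_eq0 (negPf sv) orbF => /eqP.
move: key; rewrite acp scale0r add0r => /eqP; rewrite scaler_eq0 => bcq.
rewrite [in RHS]wE scalerDr scalerA; congr (_ + _).
  move/eqP: acp; rewrite mulf_eq0 subr_eq0 => /orP[/eqP->//|/eqP->].
  by rewrite !mulr0.
by move: bcq; rewrite subr_eq0 => /orP[/eqP->//|/eqP->]; rewrite !scaler0.
Qed.

(* A periodic vector distribution is given by its Fourier coefficients: a     *)
(* family over Z^n is the coefficient family of a (unique) periodic           *)
(* distribution exactly when it has at most polynomial growth.                *)
Record periodic_dist := PeriodicDist {
  fourier_coef :> 'cV[int]_n -> 'cV[Cplx R]_n ;
  fourier_coef_growth : exists (A : R) (N : nat), forall k,
    csqnorm (fourier_coef k) <= A * (1 + sqnorm (real_vec k)) ^+ N }.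

Definition sobolev (q : R) : set periodic_dist :=
  [set g : periodic_dist |
    (\esum_(k in [set: 'cV[int]_n])
       ((1 + sqnorm (real_vec k)) `^ q * csqnorm (g k))%:E < +oo)%E].

End Vectors.

Section Smoothness.
Variables (R : realType) (V : normedModType R[i]).

(* g j is the j-th derivative of f on [0, +oo[, one-sided at the endpoint 0;  *)
(* only the values of f on [0, +oo[ matter.                                   *)
Definition smooth_ge0 (f : R -> V) : Prop :=
  exists g : nat -> R -> V,
    (forall t, 0 <= t -> g 0%N t = f t) /\
    (forall j t, 0 <= t ->
      ((s - t)^-1)%:C *: (g j s - g j t)
        @[s --> within [set s | 0 <= s] t^'] --> g j.+1 t).

End Smoothness.

Section Peridynamics.
Variables (R : realType) (n : nat) (delta beta mu lamstar : R).

Local Notation nr := (n%:R : R).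
Local Notation arg nu := (- (1 / 4) * sqnorm nu * delta ^+ 2).

Definition lambda1 (nu : 'cV[R]_n) : R :=
  - sqnorm nu *
    (3 * mu * pFq [:: 1; 5 / 2; (nr + 2 - beta) / 2]
                  [:: 2; 3 / 2; (nr + 4) / 2; (nr + 4 - beta) / 2] (arg nu)
     + (lamstar - mu) *
       pFq [:: (nr + 2 - beta) / 2]
           [:: (nr + 2) / 2; (nr + 4 - beta) / 2] (arg nu) ^+ 2).

Definition lambda2 (nu : 'cV[R]_n) : R :=
  - mu * sqnorm nu *
    pFq [:: 1; (nr + 2 - beta) / 2]
        [:: 2; (nr + 4) / 2; (nr + 4 - beta) / 2] (arg nu).

Definition multiplier (k : 'cV[int]_n) : 'M[R]_n :=
  let v := real_vec R k in eig_mx v (lambda1 v) (lambda2 v).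

(* cos (sqrt (- M_k) t), by the functional calculus of eig_mx_fun. *)
Definition cos_multiplier (k : 'cV[int]_n) (t : R) : 'M[R]_n :=
  let v := real_vec R k in
  eig_mx v (cos (Num.sqrt (- lambda1 v) * t)) (cos (Num.sqrt (- lambda2 v) * t)).

Definition u_term (b : periodic_dist R n) (x : 'cV[R]_n) (t : R)
    (k : {k : 'cV[int]_n | k != 0}) : 'cV[Cplx R]_n :=
  cis (dotp (real_vec R (val k)) x) *:
    (map_mx (real_complex R)
       ((cos_multiplier (val k) t - 1%:M) *m invmx (multiplier (val k)))
     *m b (val k)).

Definition u (b : periodic_dist R n) (x : 'cV[R]_n) (t : R) : 'cV[Cplx R]_n :=
  (t ^+ 2 / 2)%:C *: b 0 + sum (u_term b x t).

End Peridynamics.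

(* Main.v *)
Require Import Defs.
From HB Require Import structures.
From mathcomp Require Import all_boot all_order all_algebra finmap.
From mathcomp Require Import all_classical all_reals all_analysis.
From mathcomp Require Import summability complex ring lra zify.
Import Order.TTheory GRing.Theory Num.Theory.
Import numFieldNormedType.Exports.
Local Open Scope classical_set_scope.
Local Open Scope ring_scope.

(** For [beta = n] the two eigenvalues of the multiplier grow only
    logarithmically.  That is the whole point: every derivative in [t] of
    [(1 - cos (s t)) / s ^ 2], where [s ^ 2] is minus an eigenvalue at the
    frequency [k], is bounded, locally uniformly in [t], by a constant times a
    power of [1 + s], hence by a constant times any prescribed small power of
    [1 + |k| ^ 2].  The excess [S - n] of Sobolev regularity therefore absorbs
    derivatives of every order, and the Fourier series may be differentiated
    term by term as often as one likes.

    The logarithmic growth comes from the Bessel-type function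
    [0F1(; c; x) = sum_m x ^ m / ((c)_m m!)] on [x <= 0].  It solves
    [x w'' + c w' = w], and the energy [w ^ 2 - x w' ^ 2] is nondecreasing when
    [c >= 1/2], so that [|w| <= 1] there ([bessel_le1]).  When [beta = n] the
    parameters [1] and [2] of the hypergeometric functions cancel up to factors
    [1 / (m + 1)], that is, up to taking averages over the interval from [x] to
    [0].  The average of [0F1(; c + 1; .)] is [c (w - 1) / x], hence [O(1 / |x|)]
    ([xavg_bessel]), and averaging once more costs a logarithm ([avg_ln]).
    Since [|x|] is a multiple of the square of the frequency, [lambda1] and
    [lambda2] are [O(log)] ([lambda1_log], [lambda2_log]).

    The lattice sum is estimated by
    [y |b_k| <= y ^ 2 / W ^ S + W ^ S |b_k| ^ 2] with [W = 1 + |k| ^ 2]: the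
    second part is the Sobolev norm, and with [y ^ 2 = O(W ^ (S - n))] the first
    one is [O(W ^ (- n))], which is summable because it is below the product
    of the [1 / (1 + k_i ^ 2)] ([weighted_sum_bounded]).

    Instead of a theorem on uniform convergence, the termwise differentiation
    uses the second-order estimate
    [|f s - f t - (s - t) f' t| <= (s - t) ^ 2 M] for each term, with summable
    constants [M]; summed up, it gives the derivative of the series
    ([smooth_of_quadratic]). *)

Set Implicit Arguments.
Unset Strict Implicit.
Unset Printing Implicit Defensive.

(** * Entire power series *)

Section EntireSeries.
Variable R : realType.
Implicit Types (a b : nat -> R) (x : R).

(** Coefficients dominated by those of [K exp x].  This class is stable under
    differentiation, so that its power series converge everywhere and can be
    differentiated termwise without any discussion of radii. *)
Definition exp_bounded a := exists K : R, forall m, `|a m| <= K / m`!%:R.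

Definition power_sum a x : R := limn (pseries a x).

Lemma fact_gt0R m : 0 < m`!%:R :> R.
Proof. by rewrite ltr0n fact_gt0. Qed.

Lemma exp_bounded_cvg a x : exp_bounded a -> cvgn (pseries a x).
Proof.
move=> [K aK]; apply: (@normed_cvg R R^o).
apply: (@series_le_cvg _ _ (fun m => K * exp_coeff `|x| m)) => [m|m|m|].
- exact: normr_ge0.
- rewrite mulr_ge0 ?exp_coeff_ge0 //.
  by have := le_trans (normr_ge0 _) (aK 0%N); rewrite fact0 divr1.
- rewrite /= normrM normrX /exp_coeff /= (mulrC (_ ^+ _)) mulrA.
  by rewrite ler_wpM2r ?exprn_ge0.
- exact: (is_cvg_seriesZ (is_cvg_series_exp_coeff _)).
Qed.

Lemma exp_bounded_diffs a : exp_bounded a -> exp_bounded (pseries_diffs a).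
Proof.
move=> [K aK]; exists K => m; rewrite /pseries_diffs normrM normr_nat.
have := aK m.+1; rewrite factS natrM invfM mulrCA => h.
by rewrite -ler_pdivlMl ?ltr0n.
Qed.

Lemma exp_bounded_le a b : exp_bounded b -> (forall m, `|a m| <= `|b m|) ->
  exp_bounded a.
Proof. by move=> [K bK] ab; exists K => m; exact: le_trans (ab m) (bK m). Qed.

Lemma exp_boundedZ (k : R) a : exp_bounded a -> exp_bounded (fun m => k * a m).
Proof.
by move=> [K aK]; exists (`|k| * K) => m; rewrite normrM -mulrA ler_wpM2l.
Qed.

Lemma is_derive_power_sum a x : exp_bounded a ->
  is_derive x (1 : R) (power_sum a) (power_sum (pseries_diffs a) x).
Proof.
move=> ha; apply: (@pseries_snd_diffs R a (`|x| + 1) x).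
- exact: exp_bounded_cvg.
- exact/exp_bounded_cvg/exp_bounded_diffs.
- exact/exp_bounded_cvg/exp_bounded_diffs/exp_bounded_diffs.
- by rewrite [ltRHS]ger0_norm ?addr_ge0 // ltrDl.
Qed.

Lemma power_sum0 a : power_sum a 0 = a 0%N.
Proof.
apply: (@cvg_lim R^o) => //; apply: cvg_near_cst; exists 1%N => // -[//|m] _.
rewrite /pseries /series /= big_nat_recl //= expr0 mulr1 big1 ?addr0 // => i _.
by rewrite expr0n mulr0.
Qed.

Lemma eq_power_sum a b x : a =1 b -> power_sum a x = power_sum b x.
Proof. by move=> /funext ->. Qed.

Lemma power_sumD a b x : exp_bounded a -> exp_bounded b ->
  power_sum (fun m => a m + b m) x = power_sum a x + power_sum b x.
Proof.
move=> /(@exp_bounded_cvg _ x) ca /(@exp_bounded_cvg _ x) cb.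
rewrite /power_sum -(lim_seriesD ca cb); congr (limn (series _)).
by apply/funext => m /=; rewrite mulrDl.
Qed.

Lemma power_sumZ (k : R) a x : exp_bounded a ->
  power_sum (fun m => k * a m) x = k * power_sum a x.
Proof.
move=> /(@exp_bounded_cvg _ x) ca.
rewrite /power_sum -[RHS](lim_seriesZ _ ca); congr (limn (series _)).
by apply/funext => m /=; rewrite -mulrA.
Qed.

Definition shift a m : R := if m is m'.+1 then a m' else 0.

Lemma power_sum_shift a x : exp_bounded a -> power_sum (shift a) x = x * power_sum a x.
Proof.
move=> /(@exp_bounded_cvg _ x) ca.
apply: (@cvg_lim R^o) => //; rewrite -(cvg_shiftS (pseries _ _)).
rewrite (_ : (fun _ => _) = (fun m => x * pseries a x m)).
  exact: (@cvgMl_tmp R _ _ _ (fun m => pseries a x m) x).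
apply/funext => m; rewrite /pseries /series /= big_nat_recl //= mul0r add0r.
by rewrite mulr_sumr; apply: eq_bigr => i _; rewrite exprS mulrCA.
Qed.

(** The power series with coefficients [avg a] is the average from [x] to [0] of
    the one with coefficients [a]; see [is_derive_avg]. *)
Definition avg a m : R := a m / m.+1%:R.

Lemma exp_bounded_avg a : exp_bounded a -> exp_bounded (avg a).
Proof.
move=> ha; apply: (exp_bounded_le ha) => m.
by rewrite /avg normrM normfV normr_nat ler_piMr // invf_le1 ?ltr0n // ler1n.
Qed.

Lemma exp_bounded_shift a : exp_bounded a -> exp_bounded (shift (avg a)).
Proof.
move=> [K aK]; have K0 : 0 <= K.
  by have := le_trans (normr_ge0 _) (aK 0%N); rewrite fact0 divr1.
exists K => -[|m] /=; first by rewrite normr0 divr_ge0.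
rewrite /avg normrM normfV normr_nat factS natrM invfM mulrCA mulrC.
by rewrite ler_wpM2l // invr_ge0.
Qed.

Lemma diffs_shift_avg a : pseries_diffs (shift (avg a)) = a.
Proof.
by apply/funext => m; rewrite /pseries_diffs /= /avg mulrC divfK // pnatr_eq0.
Qed.

Lemma is_derive_avg a x : exp_bounded a ->
  is_derive x (1 : R) (fun y => y * power_sum (avg a) y) (power_sum a x).
Proof.
move=> ha; rewrite (_ : (fun _ => _) = power_sum (shift (avg a))).
  rewrite -[in power_sum a _](diffs_shift_avg a).
  exact/is_derive_power_sum/exp_bounded_shift.
by apply/funext => y; rewrite power_sum_shift //; exact: exp_bounded_avg.
Qed.

End EntireSeries.

(** * Comparison of functions through their derivatives *)

Section Monotone.
Variable R : realType.

Lemma derive_ge0_le (f df : R -> R) (a b : R) : a <= b ->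
  (forall x, a <= x <= b -> is_derive x 1 f (df x)) ->
  (forall x, a <= x <= b -> 0 <= df x) -> f a <= f b.
Proof.
move=> ab fd d0.
have [x xab|x|c] := @MVT_segment R f df a b ab.
- by apply: fd; move: xab; rewrite in_itv /= => /andP[/ltW -> /ltW ->].
- apply: continuous_in_subspaceT => y; rewrite inE /= in_itv /= => yab.
  by apply/differentiable_continuous/derivable1_diffP; case: (fd _ yab).
rewrite in_itv /= => cab E.
by rewrite -subr_ge0 E mulr_ge0 ?d0 // subr_ge0.
Qed.

Lemma derive_dominated (f df g dg : R -> R) (a b : R) : a <= b ->
  (forall x, a <= x <= b -> is_derive x 1 f (df x)) ->
  (forall x, a <= x <= b -> is_derive x 1 g (dg x)) ->
  (forall x, a <= x <= b -> `|df x| <= dg x) -> `|f b - f a| <= g b - g a.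
Proof.
move=> ab fd gd fg.
have h1 : g a - f a <= g b - f b.
  apply: (@derive_ge0_le (g \- f) (fun x => dg x - df x)) => // x xab /=.
    by apply: is_deriveB; [exact: gd|exact: fd].
  by rewrite subr_ge0 (le_trans (ler_norm _)) // fg.
have h2 : g a + f a <= g b + f b.
  apply: (@derive_ge0_le (g \+ f) (fun x => dg x + df x)) => // x xab /=.
    by apply: is_deriveD; [exact: gd|exact: fd].
  by rewrite addrC -[dg x]opprK subr_ge0 lerNl (le_trans (ler_norm _)) // normrN fg.
by rewrite ler_norml; apply/andP; split; lra.
Qed.

End Monotone.

(** * The function 0F1 on the negative half-line *)

Section Bessel.
Variable R : realType.
Implicit Types (c x : R).

Lemma pochhammer0 c : pochhammer c 0 = 1.
Proof. by rewrite /pochhammer big_ord0. Qed.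

Lemma pochhammerSr c m : pochhammer c m.+1 = pochhammer c m * (c + m%:R).
Proof. by rewrite /pochhammer big_ord_recr. Qed.

Lemma pochhammerS c m : pochhammer c m.+1 = c * pochhammer (c + 1) m.
Proof.
rewrite /pochhammer big_ord_recl addr0; congr (_ * _).
by apply: eq_bigr => i _; rewrite lift0 -natr1 -addrA (addrC 1).
Qed.

Lemma pochhammer_gt0 c m : 0 < c -> 0 < pochhammer c m.
Proof. by move=> c0; apply: prodr_gt0 => i _; rewrite ltr_wpDr. Qed.

Lemma pochhammer_ge1 c m : 1 <= c -> 1 <= pochhammer c m.
Proof.
move=> c1; elim: m => [|m IH]; first by rewrite pochhammer0.
rewrite pochhammerSr -[leLHS]mulr1 ler_pM // ler_wpDr //.
Qed.

Lemma pochhammer1 m : pochhammer 1 m = m`!%:R :> R.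
Proof.
elim: m => [|m IH]; first by rewrite pochhammer0.
by rewrite pochhammerSr IH factS mulrC natrM -natr1 (addrC 1).
Qed.

Lemma pochhammer2 m : pochhammer 2 m = m.+1`!%:R :> R.
Proof. by rewrite -pochhammer1 pochhammerS mul1r. Qed.

(** These are the coefficients of [0F1(; c; x)], which for [x < 0] is a multiple
    of [|x| ^ ((1 - c) / 2) J_(c-1) (2 |x| ^ (1/2))], with [J] the Bessel
    function. *)
Definition bessel_coef c (m : nat) : R := (pochhammer c m * m`!%:R)^-1.

Lemma exp_bounded_bessel c : 0 < c -> exp_bounded (bessel_coef c).
Proof.
move=> c0; exists (1 + c^-1) => m.
have p0 k : 0 <= (pochhammer (c + 1) k)^-1 by rewrite invr_ge0 ltW // pochhammer_gt0 // addr_gt0.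
rewrite /bessel_coef invfM normrM ger0_norm; last by rewrite invr_ge0 ltW // pochhammer_gt0.
rewrite ger0_norm ?invr_ge0 // ler_wpM2r ?invr_ge0 //.
have c1 : 0 <= c^-1 by rewrite invr_ge0 ltW.
case: m => [|m]; first by rewrite pochhammer0 invr1 lerDl.
rewrite pochhammerS invfM ler_wpDl // ler_piMr //.
rewrite invf_le1; first by rewrite pochhammer_ge1 // lerDr ltW.
by rewrite pochhammer_gt0 // addr_gt0.
Qed.

Lemma diffs_bessel c m : 0 < c -> pseries_diffs (bessel_coef c) m = c^-1 * bessel_coef (c + 1) m.
Proof.
move=> c0; rewrite /pseries_diffs /bessel_coef pochhammerS factS natrM.
have := pochhammer_gt0 m (addr_gt0 c0 ltr01); have := fact_gt0R R m.
move: (pochhammer _ _) (_%:R) => p q q0 p0.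
have : m.+1%:R != 0 :> R by rewrite pnatr_eq0.
by move=> ?; field; rewrite ?gt_eqF // ?p0 ?q0 ?c0.
Qed.

Definition bessel c x := power_sum (bessel_coef c) x.

Lemma bessel0 c : bessel c 0 = 1.
Proof. by rewrite /bessel power_sum0 /bessel_coef pochhammer0 fact0 mulr1 invr1. Qed.

Lemma is_derive_bessel c x : 0 < c -> is_derive x 1 (bessel c) (c^-1 * bessel (c + 1) x).
Proof.
move=> c0; have := @is_derive_power_sum R _ x (exp_bounded_bessel c0).
rewrite (_ : power_sum _ x = c^-1 * bessel (c + 1) x) //.
rewrite -power_sumZ; last exact/exp_bounded_bessel/addr_gt0.
by apply: eq_power_sum => m; exact: diffs_bessel.
Qed.

(** Contiguity relation; it turns into the differential equation because
    differentiation shifts the parameter [c] by one. *)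
Lemma bessel_contiguous c x : 0 < c ->
  x * ((c + 1)^-1 * bessel (c + 1 + 1) x) = c * (bessel c x - bessel (c + 1) x).
Proof.
move=> c0; have c10 : 0 < c + 1 by rewrite addr_gt0.
have c20 : 0 < c + 1 + 1 by rewrite addr_gt0.
have [e0 e1 e2] := And3 (exp_bounded_bessel c0) (exp_bounded_bessel c10)
  (exp_bounded_bessel c20).
rewrite -power_sumZ //.
rewrite -(eq_power_sum _ (fun m => diffs_bessel m c10)) -power_sum_shift; last first.
  exact: exp_bounded_diffs.
rewrite mulrBr -power_sumZ // -mulNr -power_sumZ // -power_sumD; last 2 first.
- exact: exp_boundedZ.
- exact: exp_boundedZ.
apply: eq_power_sum => -[|m] /=.
  by rewrite /bessel_coef !pochhammer0 mulNr subrr.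
rewrite diffs_bessel // /bessel_coef (pochhammerS c) (pochhammerS (c + 1)) factS natrM.
have pE : pochhammer (c + 1) m = (c + 1) * pochhammer (c + 1 + 1) m / (c + 1 + m%:R).
  by rewrite -pochhammerS pochhammerSr mulfK // gt_eqF // ltr_wpDr.
have := pochhammer_gt0 m c20; have := fact_gt0R R m; rewrite pE.
have : 0 < c + 1 + m%:R by rewrite ltr_wpDr.
rewrite -natr1; have : 0 <= m%:R :> R by [].
move: (pochhammer _ _) (m`!%:R) (m%:R) => p q k k0 ck q0 p0.
have : k + 1 != 0 by rewrite gt_eqF // ltr_wpDl.
by move=> k10; field; rewrite k10 !lt0r_neq0.
Qed.

Definition dbessel c x := c^-1 * bessel (c + 1) x.

Definition ddbessel c x := c^-1 * dbessel (c + 1) x.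

Lemma is_derive_dbessel c x : 0 < c -> is_derive x 1 (dbessel c) (ddbessel c x).
Proof.
move=> c0; rewrite /dbessel.
have := is_derive_bessel x (addr_gt0 c0 ltr01).
by move=> /(@is_deriveZ R R R (bessel (c + 1)) c^-1).
Qed.

Lemma bessel_ode c x : 0 < c -> x * ddbessel c x + c * dbessel c x = bessel c x.
Proof.
move=> c0; rewrite /ddbessel mulrCA /dbessel bessel_contiguous //.
by rewrite mulrA mulVf ?gt_eqF // mul1r (mulVKf (lt0r_neq0 c0)) subrK.
Qed.

(** Along the differential equation, the energy [w ^ 2 - x w' ^ 2] has
    derivative [(2 c - 1) w' ^ 2 >= 0] and value [1] at [0]. *)
Lemma bessel_le1 c x : 2^-1 <= c -> x <= 0 -> `|bessel c x| <= 1.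
Proof.
move=> c2 x0; have c0 : 0 < c by apply: lt_le_trans c2; rewrite invr_gt0.
pose E y := bessel c y ^+ 2 - y * dbessel c y ^+ 2.
have : E x <= E 0.
  apply: (@derive_ge0_le R E (fun y => (2 * c - 1) * dbessel c y ^+ 2)) => //.
    move=> y _; have h1 := is_derive_bessel y c0; have h2 := is_derive_dbessel y c0.
    rewrite /E; apply: is_derive_eq.
    by rewrite -/(dbessel c y) -(bessel_ode y c0) /GRing.scale /=; ring.
  by move=> y _; rewrite mulr_ge0 ?sqr_ge0 //; lra.
rewrite /E bessel0 mul0r subr0 expr1n => E1.
rewrite -(@ler_pXn2r _ 2) ?nnegrE // expr1n real_normK ?num_real //.
by apply: le_trans E1; rewrite lerDl oppr_ge0 mulr_le0_ge0 // sqr_ge0.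
Qed.

Lemma avg_le1 (a : nat -> R) x : exp_bounded a ->
  (forall y, y <= 0 -> `|power_sum a y| <= 1) -> x <= 0 -> `|power_sum (avg a) x| <= 1.
Proof.
move=> ha a1 x0; have := x0; rewrite le_eqVlt => /orP[/eqP->|xlt0].
  by have := a1 0 (lexx _); rewrite !power_sum0 /avg divr1.
have := @derive_dominated R (fun y => y * power_sum (avg a) y) (power_sum a) id (fun=> 1) x 0 x0.
rewrite mul0r !sub0r normrN normrM ltr0_norm // ger_pMr ?oppr_gt0 //; apply.
- by move=> y _; exact: is_derive_avg.
- by move=> y /andP[_ y0]; exact: a1.
Qed.

(** The derivative of [x] times the average is the averaged function, which the
    two hypotheses bound by [(1 + C) / (1 + |x|)]. *)
Lemma avg_ln (a : nat -> R) (C x : R) : exp_bounded a ->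
  (forall y, y <= 0 -> `|power_sum a y| <= 1) ->
  (forall y, y <= 0 -> `|y * power_sum a y| <= C) ->
  x <= 0 -> `|x * power_sum (avg a) x| <= (1 + C) * ln (1 - x).
Proof.
move=> ha a1 aC x0.
have := @derive_dominated R (fun y => y * power_sum (avg a) y) (power_sum a)
  (fun y => - (1 + C) * ln (1 - y)) (fun y => (1 + C) / (1 - y)) x 0 x0.
rewrite mul0r sub0r normrN subr0 ln1 mulr0 sub0r mulNr opprK; apply.
- by move=> y _; exact: is_derive_avg.
- move=> y /andP[_ y0]; have y1 : 0 < 1 - y by lra.
  have h := is_derive1_ln y1.
  have h2 : is_derive y 1 (fun z : R => 1 - z) (-1).
    have := is_deriveB (is_derive_cst (1 : R) y 1) (is_derive_id y (1 : R)).
    by move=> /is_derive_eq; apply; rewrite sub0r.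
  have := @is_derive1_comp R _ _ y _ _ h h2.
  move=> /(@is_deriveZ R R R _ (- (1 + C))).
  by move=> /is_derive_eq; apply; rewrite /GRing.scale /=; ring.
- move=> y /andP[_ y0]; have y1 : 0 < 1 - y by lra.
  rewrite ler_pdivlMr // mulrBr mulr1.
  have := aC y y0; have := a1 y y0; rewrite normrM (ler0_norm y0); lra.
Qed.

(** [0F1(; c + 1; .)] is [c] times the derivative of [0F1(; c; .)], so its
    integral is explicit. *)
Lemma xavg_bessel c x : 0 < c -> x <= 0 ->
  x * power_sum (avg (bessel_coef (c + 1))) x = c * (bessel c x - 1).
Proof.
move=> c0 x0; have c10 : 0 < c + 1 by rewrite addr_gt0.
have := @derive_dominated R
  (fun y => y * power_sum (avg (bessel_coef (c + 1))) y - c * bessel c y)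
  (fun=> 0) (fun=> 0) (fun=> 0) x 0 x0.
rewrite mul0r bessel0 mulr1 !subrr => h.
apply/eqP; rewrite eq_sym -subr_eq0 -normr_le0.
rewrite (_ : _ - _ = 0 - c -
  (x * power_sum (avg (bessel_coef (c + 1))) x - c * bessel c x)); last by ring.
apply: h => y _.
- have h1 := @is_derive_avg R _ y (exp_bounded_bessel c10).
  have h2 := is_deriveZ c (is_derive_bessel y c0).
  have := is_deriveB h1 h2.
  by move=> /is_derive_eq; apply; rewrite /GRing.scale /= mulVKf ?gt_eqF // subrr.
- by rewrite normr0.
Qed.

Lemma xavg_bessel_le c x : 2^-1 <= c -> x <= 0 ->
  `|x * power_sum (avg (bessel_coef (c + 1))) x| <= 2 * c.
Proof.
move=> c2 x0; have c0 : 0 < c by apply: lt_le_trans c2; rewrite invr_gt0.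
rewrite xavg_bessel // normrM gtr0_norm // mulrC ler_wpM2r ?(ltW c0) //.
have := bessel_le1 c2 x0; rewrite !ler_norml; lra.
Qed.

(** The factors [(1)_m / (2)_m = 1 / (m + 1)] are those of [avg], whence the next
    three identities.  In the third one, [(5/2)_m / (3/2)_m = 1 + 2 m / 3] is
    split as [1 / 3 + 2 (m + 1) / 3], and the factor [m + 1] undoes one
    average. *)
Lemma pFq_1F2 c x : 0 < c -> pFq [:: 1] [:: c; 2] x = power_sum (avg (bessel_coef c)) x.
Proof.
move=> c0; rewrite /pFq /power_sum /pseries; congr (limn (series _)); apply/funext => m.
rewrite !(big_cons, big_nil) /= pochhammer1 pochhammer2 !mulr1 factS natrM /avg /bessel_coef.
have := pochhammer_gt0 m c0; have := fact_gt0R R m.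
have : 0 < m.+1%:R :> R by rewrite ltr0n.
move: (pochhammer _ _) (m`!%:R) (m.+1%:R) => p q k k0 q0 p0.
by field; rewrite !lt0r_neq0.
Qed.

Lemma pFq_2F3 c x : 0 < c ->
  pFq [:: 1; 1] [:: 2; c; 2] x = power_sum (avg (avg (bessel_coef c))) x.
Proof.
move=> c0; rewrite /pFq /power_sum /pseries; congr (limn (series _)); apply/funext => m.
rewrite !(big_cons, big_nil) /= pochhammer1 pochhammer2 !mulr1 factS natrM /avg /bessel_coef.
have := pochhammer_gt0 m c0; have := fact_gt0R R m.
have : 0 < m.+1%:R :> R by rewrite ltr0n.
move: (pochhammer _ _) (m`!%:R) (m.+1%:R) => p q k k0 q0 p0.
by field; rewrite !lt0r_neq0.
Qed.

Lemma pFq_3F4 c x : 0 < c ->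
  pFq [:: 1; 5 / 2; 1] [:: 2; 3 / 2; c; 2] x =
  3^-1 * power_sum (avg (avg (bessel_coef c))) x + 2 / 3 * power_sum (avg (bessel_coef c)) x.
Proof.
move=> c0; have eb := exp_bounded_avg (exp_bounded_bessel c0).
rewrite -!power_sumZ //; last exact: exp_bounded_avg.
rewrite -power_sumD; [|by apply: exp_boundedZ; try exact: exp_bounded_avg..].
rewrite /pFq /power_sum /pseries; congr (limn (series _)); apply/funext => m.
rewrite !(big_cons, big_nil) /= pochhammer1 pochhammer2 !mulr1 factS natrM /avg /bessel_coef.
have -> : pochhammer (5 / 2) m = pochhammer (3 / 2) m * (3 / 2 + m%:R) / (3 / 2) :> R.
  rewrite -pochhammerSr pochhammerS (_ : 3 / 2 + 1 = 5 / 2 :> R); last by field.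
  by rewrite [RHS]mulrC mulKf //; lra.
have := @pochhammer_gt0 (3 / 2) m (ltac:(lra)).
have := pochhammer_gt0 m c0; have := fact_gt0R R m; rewrite -[m.+1%:R]natr1.
have : 0 < m%:R + 1 :> R by rewrite ltr_wpDl.
move: (pochhammer _ _) (pochhammer _ _) (m`!%:R) (m%:R) => p p' q k k0 q0 p0 p0'.
by field; rewrite !lt0r_neq0.
Qed.

End Bessel.

(** * Growth of the eigenvalues *)

Section LambdaGrowth.
Variable R : realType.

Lemma sqnorm_ge0 n (v : 'cV[R]_n) : 0 <= sqnorm v.
Proof. by apply: sumr_ge0 => i _; exact: sqr_ge0. Qed.

Lemma ln1D_scaled_le (a e : R) : 0 <= a -> 0 < e ->
  exists2 C : R, 0 <= C & forall q, 0 <= q -> 1 + ln (1 + a * q) <= C * (1 + q) `^ e.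
Proof.
move=> a0 e0; exists (1 + ln (1 + a) + e^-1).
  by rewrite !addr_ge0 ?ln_ge0 ?lerDl // invr_ge0 ltW.
move=> q q0; have q1 : 0 < 1 + q by lra.
have a1 : 0 < 1 + a by lra.
have W1 : 1 <= (1 + q) `^ e by rewrite -[leLHS](powRr0 (1 + q)) ler_powR ?lerDl // ltW.
apply: (@le_trans _ _ (1 + (ln (1 + a) + ln (1 + q)))).
  rewrite lerD2l -lnM ?posrE // ler_ln ?posrE ?mulr_gt0 //.
    by have := mulr_ge0 a0 q0; nra.
  by have := mulr_ge0 a0 q0; nra.
rewrite addrA mulrDl lerD //.
  by rewrite ler_peMr // addr_ge0 // ln_ge0 // lerDl.
rewrite mulrC ler_pdivlMr // mulrC -ln_powR.
by rewrite ltW // ln_sublinear // (lt_le_trans _ W1).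
Qed.

Variables (n : nat) (delta mu lamstar : R).
Hypotheses (n1 : (1 <= n)%N) (delta0 : 0 < delta).

(** With [x] the argument of the hypergeometric function, [lambda2] is
    [4 mu / delta ^ 2] times [x] times a twofold average of
    [0F1(; n / 2 + 2; .)]. *)
Lemma lambda2_log (nu : 'cV[R]_n) :
  `|lambda2 delta n%:R mu nu| <=
  4 / delta ^+ 2 * `|mu| * (n%:R + 3) * (1 + ln (1 + delta ^+ 2 / 4 * sqnorm nu)).
Proof.
rewrite /lambda2 (_ : (n%:R + 2 - n%:R) / 2 = 1); last by field.
rewrite (_ : (n%:R + 4 - n%:R) / 2 = 2); last by field.
set x := - (1 / 4) * _ * _.
have n0 : 1 <= n%:R :> R by rewrite ler1n.
set c : R := (n%:R + 2) / 2.
rewrite (_ : (n%:R + 4) / 2 = c + 1); last by rewrite /c; field.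
have c0 : 0 < c by rewrite /c; lra.
have c1 : 0 < c + 1 by lra.
have dn0 : delta != 0 by rewrite gt_eqF.
have q0 := sqnorm_ge0 nu.
have x0 : x <= 0 by rewrite /x; have := mulr_ge0 q0 (sqr_ge0 delta); lra.
rewrite pFq_2F3 //.
rewrite (_ : - mu * _ * _ = (4 / delta ^+ 2) * mu *
  (x * power_sum (avg (avg (bessel_coef (c + 1)))) x)); last first.
  rewrite /x; move: (power_sum _ _) => K; move: (sqnorm nu) => q; by field.
have := @avg_ln R (avg (bessel_coef (c + 1))) (2 * c) x.
rewrite (_ : 1 - x = 1 + delta ^+ 2 / 4 * sqnorm nu); last by rewrite /x; field.
have : 0 <= 4 / delta ^+ 2 by rewrite divr_ge0 ?sqr_ge0.
move: (4 / _) => k k0 h.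
rewrite 2!normrM (ger0_norm k0) -(mulrA _ (n%:R + 3)) ler_wpM2l ?mulr_ge0 //.
apply: le_trans (h _ _ _ _) _ => //.
- exact/exp_bounded_avg/exp_bounded_bessel.
- move=> y y0; apply: avg_le1 => //; first exact: exp_bounded_bessel.
  by move=> z z0; apply: bessel_le1 => //; rewrite /c; lra.
- by move=> y y0; apply: xavg_bessel_le => //; rewrite /c; lra.
- have : 0 <= ln (1 + delta ^+ 2 / 4 * sqnorm nu).
    by rewrite ln_ge0 // lerDl mulr_ge0 // divr_ge0 ?sqr_ge0.
  rewrite /c; move: (ln _) => l l0; nra.
Qed.

(** The [3F4] part is treated like [lambda2].  In the other part, the square
    of the [1F2] function [H] is multiplied by [x]; since [H] and [x H] are
    both bounded, it stays bounded. *)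
Lemma lambda1_log : exists C : R, forall nu : 'cV[R]_n,
  `|lambda1 delta n%:R mu lamstar nu| <=
  C * (1 + ln (1 + delta ^+ 2 / 4 * sqnorm nu)).
Proof.
have n0 : 1 <= n%:R :> R by rewrite ler1n.
exists (4 / delta ^+ 2 * (3 * `|mu| * (2 * (n%:R + 3)) + `|lamstar - mu| * (n%:R + 3))) => nu.
rewrite /lambda1 (_ : (n%:R + 2 - n%:R) / 2 = 1); last by field.
rewrite (_ : (n%:R + 4 - n%:R) / 2 = 2); last by field.
set x := - (1 / 4) * _ * _.
set c : R := (n%:R + 2) / 2.
rewrite (_ : (n%:R + 4) / 2 = c + 1); last by rewrite /c; field.
have c0 : 0 < c by rewrite /c; lra.
have c1 : 0 < c + 1 by lra.
have dn0 : delta != 0 by rewrite gt_eqF.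
have q0 := sqnorm_ge0 nu.
have x0 : x <= 0 by rewrite /x; have := mulr_ge0 q0 (sqr_ge0 delta); lra.
rewrite pFq_3F4 // pFq_1F2 //.
set K := power_sum (avg (avg _)) x.
set J := power_sum (avg _) x.
set H := power_sum (avg (bessel_coef c)) x.
rewrite (_ : - sqnorm nu * _ = (4 / delta ^+ 2) *
  (3 * mu * (3^-1 * (x * K) + 2 / 3 * (x * J)) + (lamstar - mu) * ((x * H) * H))); last first.
  by rewrite /x; move: K J H (sqnorm nu) => K J H q; field.
have hK : `|x * K| <= (1 + 2 * c) * ln (1 - x).
  apply: avg_ln => //.
  - exact/exp_bounded_avg/exp_bounded_bessel.
  - move=> y y0; apply: avg_le1 => //; first exact: exp_bounded_bessel.
    by move=> z z0; apply: bessel_le1 => //; rewrite /c; lra.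
  - by move=> y y0; apply: xavg_bessel_le => //; rewrite /c; lra.
have hJ : `|x * J| <= 2 * c by apply: xavg_bessel_le => //; rewrite /c; lra.
(* here the Bessel bound is used for the parameter c - 1 = n / 2, which is at
   least 1/2 exactly because n >= 1 *)
have hH : `|x * H| <= 2 * (c - 1).
  have := @xavg_bessel_le R (c - 1) x; rewrite subrK => h; apply: h => //; rewrite /c; lra.
have hH1 : `|H| <= 1.
  apply: avg_le1 => //; first exact: exp_bounded_bessel.
  by move=> z z0; apply: bessel_le1 => //; rewrite /c; lra.
move: hK; rewrite (_ : 1 - x = 1 + delta ^+ 2 / 4 * sqnorm nu); last by rewrite /x; field.
have : 0 <= ln (1 + delta ^+ 2 / 4 * sqnorm nu).
  by rewrite ln_ge0 // lerDl mulr_ge0 // divr_ge0 ?sqr_ge0.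
move: (ln _) => l l0 hK.
have : 0 <= 4 / delta ^+ 2 by rewrite divr_ge0 ?sqr_ge0.
move: (4 / _) => k k0.
rewrite normrM (ger0_norm k0) -(mulrA k) ler_wpM2l // [leRHS]mulrDl.
apply: le_trans (ler_normD _ _) _; apply: lerD.
  rewrite 2!normrM normr_nat -(mulrA (3 * `|mu|)) ler_wpM2l ?mulr_ge0 //.
  apply: le_trans (ler_normD _ _) _.
  rewrite (normrM 3^-1) (normrM (2 / 3)) (@ger0_norm _ 3^-1) // (@ger0_norm _ (2 / 3)) //.
  by move: hK hJ; rewrite /c; nra.
rewrite [in leLHS]normrM -(mulrA `|lamstar - mu|) ler_wpM2l // normrM.
apply: le_trans (ler_pM _ _ hH hH1) _ => //.
by rewrite /c; nra.
Qed.

Lemma lambda_subpolynomial (e : R) : 0 < e -> exists2 C : R, 0 <= C &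
  forall nu : 'cV[R]_n,
    `|lambda1 delta n%:R mu lamstar nu| <= C * (1 + sqnorm nu) `^ e /\
    `|lambda2 delta n%:R mu nu| <= C * (1 + sqnorm nu) `^ e.
Proof.
move=> e0; have [C1 h1] := lambda1_log.
have d4 : 0 <= delta ^+ 2 / 4 by rewrite divr_ge0 ?sqr_ge0.
have [C C0 hC] := ln1D_scaled_le d4 e0.
set C2 := 4 / delta ^+ 2 * `|mu| * (n%:R + 3).
exists ((`|C1| + `|C2|) * C); first by rewrite mulr_ge0 ?addr_ge0.
move=> nu; have q0 := sqnorm_ge0 nu; have L := hC _ q0.
set l := (X in X <= _) in L; have L0 : 0 <= l by rewrite addr_ge0 // ln_ge0 // lerDl mulr_ge0.
split; [apply: le_trans (h1 nu) _ | apply: le_trans (lambda2_log nu) _].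
  rewrite -(mulrA _ C); apply: (@le_trans _ _ ((`|C1| + `|C2|) * l)).
    by rewrite ler_wpM2r // (le_trans (ler_norm _)) // lerDl.
  by rewrite ler_wpM2l // addr_ge0.
rewrite -/C2 -(mulrA _ C); apply: (@le_trans _ _ ((`|C1| + `|C2|) * l)).
  by rewrite ler_wpM2r // (le_trans (ler_norm _)) // lerDr.
by rewrite ler_wpM2l // addr_ge0.
Qed.

End LambdaGrowth.

(** * Unconditional sums *)

#[local] Existing Instance totally_filter.

Section Families.
Variables (R : realType) (I : choiceType).

Lemma partial_sumE (V : zmodType) (a : I -> V) (J : {fset I}) :
  partial_sum a J = \sum_(i <- J) a i.
Proof. by rewrite /partial_sum (big_seq_fsetE _ J xpredT a). Qed.

Lemma partial_sum_le (a b : I -> R) (J : {fset I}) :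
  (forall i, a i <= b i) -> partial_sum a J <= partial_sum b J.
Proof. by move=> ab; rewrite !partial_sumE ler_sum. Qed.

Lemma partial_sum_incl (a : I -> R) (A B : {fset I}) : (forall i, 0 <= a i) ->
  (A `<=` B)%fset -> partial_sum a A <= partial_sum a B.
Proof.
move=> a0 AB; rewrite !partial_sumE [leRHS](@big_fsetID _ _ _ _ (fun i => i \in A)) /=.
rewrite (_ : [fset x in B | x \in A]%fset = A) ?lerDl ?sumr_ge0 //.
apply/fsetP => i; rewrite !inE /= andbC.
by case: (boolP (i \in A)) => // /(fsubsetP AB).
Qed.

Lemma cvg_partial_sum_ge0 (a : I -> R) (M : R) : (forall i, 0 <= a i) ->
  (forall J, partial_sum a J <= M) ->
  exists l : R, partial_sum a @ totally --> l.
Proof.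
move=> a0 aM; pose E := range (partial_sum a); exists (sup E).
have hE : has_sup E.
  by split; [exists (partial_sum a fset0); exists fset0|exists M => _ [J _ <-]].
apply/cvgrPdist_le => e e0; have [_ [A _ <-] hA] := sup_adherent e0 hE.
exists A => // B AB /=.
rewrite ger0_norm ?subr_ge0; last by apply: sup_upper_bound => //; exists B.
by have := partial_sum_incl a0 AB; lra.
Qed.

Lemma cvg_partial_sum_abs (a : I -> R) (M : R) :
  (forall J, partial_sum (fun i => `|a i|) J <= M) ->
  exists l : R, partial_sum a @ totally --> l.
Proof.
move=> aM.
have [l1 h1] := cvg_partial_sum_ge0 (fun i => normr_ge0 (a i)) aM.
have [i|J|l2 h2] := @cvg_partial_sum_ge0 (fun i => `|a i| + a i) (M + M).
- by have := ler_norm (- a i); rewrite normrN; lra.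
- rewrite !partial_sumE big_split /= lerD // -?partial_sumE //.
  by apply: le_trans (aM J); apply: partial_sum_le => i; exact: ler_norm.
exists (l2 - l1).
rewrite (_ : partial_sum a = (fun J => partial_sum (fun i => `|a i| + a i) J -
  partial_sum (fun i => `|a i|) J)); first exact: cvgB.
apply/funext => J; rewrite !partial_sumE -sumrB.
by apply: eq_bigr => i _; rewrite addrAC subrr add0r.
Qed.

End Families.

Section ComplexVectors.
Local Open Scope complex_scope.
Variables (R : realType) (n : nat).
Local Notation V := ('cV[Cplx R]_n).

Lemma normC_le (z : Cplx R) : `|z| <= (`|complex.Re z| + `|complex.Im z|)%:C.
Proof.
rewrite normc_def lecR -[leRHS]ger0_norm ?addr_ge0 // -sqrtr_sqr ler_wsqrtr //.
rewrite sqrrD !real_normK ?num_real // -addrA lerD2l lerDr.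
by rewrite mulrn_wge0 // mulr_ge0.
Qed.

Lemma Re_le_normC (z : Cplx R) : (`|complex.Re z|)%:C <= `|z|.
Proof. by rewrite normc_def lecR -sqrtr_sqr ler_wsqrtr // lerDl sqr_ge0. Qed.

Lemma Im_le_normC (z : Cplx R) : (`|complex.Im z|)%:C <= `|z|.
Proof. by rewrite normc_def lecR -sqrtr_sqr ler_wsqrtr // lerDr sqr_ge0. Qed.

Lemma cV_norm_le (v : V) (M : R) : 0 <= M ->
  (forall i, `|v i 0| <= M%:C) -> `|v| <= M%:C.
Proof.
move=> M0 vM; have -> : `|v| = mx_norm v by [].
have [->|/mx_norm_neq0[[i j] /= ->]] := eqVneq (mx_norm v) 0; first by rewrite ler0c.
by rewrite (ord1 j).
Qed.

Lemma cV_entry_norm (v : V) i : `|v i 0| <= `|v|.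
Proof.
have -> : `|v| = mx_norm v by []; rewrite mx_normE.
have : (`|v i 0|%:nng <= \big[Num.max/0%:nng]_ij `|v ij.1 ij.2|%:nng)%O.
  exact: (le_bigmax _ _ (i, 0)).
by rewrite -num_le.
Qed.

Lemma cvg_cV (T : Type) (F : set_system T) (f : T -> V) (l : V) : Filter F ->
  (forall i, (fun x => complex.Re (f x i 0)) @ F --> complex.Re (l i 0)) ->
  (forall i, (fun x => complex.Im (f x i 0)) @ F --> complex.Im (l i 0)) ->
  f @ F --> l.
Proof.
move=> FF hr hi; apply/cvgrPdist_le => -[e e'] e0.
have [e00 e'0] : 0 < e /\ e' = 0 by move: e0; rewrite ltcE /= => /andP[/eqP -> ->].
have e2 : 0 < e / 2 by rewrite divr_gt0.
have H i : \forall x \near F, `|(l - f x) i 0| <= e%:C.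
  have /cvgrPdist_le/(_ _ e2) h1 := hr i; have /cvgrPdist_le/(_ _ e2) h2 := hi i.
  near=> x; apply: le_trans (normC_le _) _; rewrite lecR (splitr e) lerD //.
    by rewrite !mxE raddfB /=; near: x.
  by rewrite !mxE raddfB /=; near: x.
have {}H : \forall x \near F, forall i, `|(l - f x) i 0| <= e%:C.
  exact: filter_forall.
by rewrite e'0; apply: filterS H => x; apply: cV_norm_le; rewrite ltW.
Unshelve. all: by end_near. Qed.

Variable I : choiceType.
Implicit Types (f : I -> V) (a : I -> R).

(** The real and imaginary parts of the entries are real families with bounded
    absolute partial sums, and these converge by the least upper bound
    property. *)
Lemma cvg_family f a (M : R) : (forall i, `|f i| <= (a i)%:C) ->
  (forall J, partial_sum a J <= M) -> cvg (partial_sum f @ totally).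
Proof.
move=> fa aM.
have hr i : exists l : R, partial_sum (fun k => complex.Re (f k i 0)) @ totally --> l.
  apply: (@cvg_partial_sum_abs _ _ _ M) => J; apply: le_trans (aM J).
  apply: partial_sum_le => k; rewrite -lecR.
  exact: le_trans (Re_le_normC _) (le_trans (cV_entry_norm _ _) (fa k)).
have hi i : exists l : R, partial_sum (fun k => complex.Im (f k i 0)) @ totally --> l.
  apply: (@cvg_partial_sum_abs _ _ _ M) => J; apply: le_trans (aM J).
  apply: partial_sum_le => k; rewrite -lecR.
  exact: le_trans (Im_le_normC _) (le_trans (cV_entry_norm _ _) (fa k)).
have [lr hlr] := choice hr; have [li hli] := choice hi.
apply/cvg_ex; exists (\col_i (lr i +i* li i)); apply: cvg_cV => i.
  rewrite (_ : (fun J => _) = partial_sum (fun k => complex.Re (f k i 0))).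
    by rewrite mxE; exact: hlr.
  by apply/funext => J; rewrite !partial_sumE summxE raddf_sum.
rewrite (_ : (fun J => _) = partial_sum (fun k => complex.Im (f k i 0))).
  by rewrite mxE; exact: hli.
by apply/funext => J; rewrite !partial_sumE summxE raddf_sum.
Qed.

Lemma norm_sum_le f a (M : R) : (forall i, `|f i| <= (a i)%:C) ->
  (forall J, partial_sum a J <= M) -> `|sum f| <= M%:C.
Proof.
move=> fa aM; have cf := cvg_family fa aM.
apply/ler_addgt0Pr => e e0.
have /cvgrPdist_le/(_ _ e0) [A _ hA] := cf.
have /= h := hA A (fsubset_refl _).
rewrite -[sum f](subrK (partial_sum f A)) addrC (le_trans (ler_normD _ _)) //.
rewrite lerD // partial_sumE (le_trans (ler_norm_sum _ _ _)) //.
apply: (@le_trans _ _ (\sum_(i <- A) (a i)%:C)); first by apply: ler_sum => i _.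
by rewrite -rmorph_sum lecR -partial_sumE.
Qed.

End ComplexVectors.

(** * Smoothness from second-order estimates *)

Section SmoothCriterion.
Local Open Scope complex_scope.
Variable R : realType.

Lemma norm_real_complex (a : R) : `|a%:C| = (`|a|)%:C :> R[i].
Proof. by rewrite normc_def /= expr0n addr0 sqrtr_sqr. Qed.

Lemma sum_quotient (I : choiceType) (V : normedModType R[i]) (f g h : I -> V) (c : R[i]) :
  cvg (partial_sum f @ totally) -> cvg (partial_sum g @ totally) ->
  cvg (partial_sum h @ totally) ->
  sum (fun i => f i - g i - c *: h i) = sum f - sum g - c *: sum h.
Proof.
move=> cf cg ch; apply: cvg_lim => //.
rewrite (_ : partial_sum _ = (fun J => partial_sum f J - partial_sum g J - c *: partial_sum h J)).
  by apply: cvgB; [exact: cvgB|apply: cvgZl_tmp].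
by apply/funext => J; rewrite !partial_sumE scaler_sumr -!sumrB.
Qed.

(** Such an estimate survives summation over the frequencies, contrary to
    differentiability, and it bounds the error of the difference quotient by
    [|s - t| M]. *)
Lemma smooth_of_quadratic (V : normedModType R[i]) (G : nat -> R -> V) (f : R -> V) :
  (forall t, 0 <= t -> G 0%N t = f t) ->
  (forall j, exists M : R, forall s t, 0 <= s -> 0 <= t ->
    `|G j s - G j t - (s - t)%:C *: G j.+1 t| <= ((s - t) ^+ 2 * M)%:C) ->
  smooth_ge0 f.
Proof.
move=> G0 GM; exists G; split=> // j t t0; have [M hM] := GM j.
apply/cvgrPdist_le => -[e e'] e0.
have [e00 e'0] : 0 < e /\ e' = 0 by move: e0; rewrite ltcE /= => /andP[/eqP -> ->].
have d0 : 0 < e / (`|M| + 1) by rewrite divr_gt0 // ltr_wpDl.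
exists (e / (`|M| + 1)) => //= s st sNt s0.
have stN0 : s - t != 0 by rewrite subr_eq0.
have cst : (s - t)%:C != 0 :> R[i] by rewrite eq_complex /= eqxx andbT.
rewrite -normrN opprB -[G j.+1 t](scalerK cst).
rewrite rmorphV ?unitfE //= -scalerBr normrZ normfV.
rewrite ler_pdivrMl ?normr_gt0 // (le_trans (hM s t s0 t0)) //.
rewrite norm_real_complex e'0 -rmorphM /= lecR -real_normK ?num_real // expr2 -mulrA ler_wpM2l //.
move: st; rewrite /= -normrN opprB ltr_pdivlMr ?ltr_wpDl // => /ltW.
apply: le_trans; rewrite ler_wpM2l //.
by apply: le_trans (ler_norm _) _; rewrite lerDl.
Qed.

End SmoothCriterion.

Section Oscillators.
Variable R : realType.

Lemma is_derive_mulr (k z : R) : is_derive z 1 (fun y : R => k * y) k.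
Proof.
have := is_deriveZ k (is_derive_id z (1 : R)).
by move=> /is_derive_eq; apply; rewrite /GRing.scale /= mulr1.
Qed.

(** Stated without an order between [a] and [b], so that it can be applied to
    increments of either sign. *)
Lemma lipschitz_of_derive (f df : R -> R) (a b M : R) :
  (forall z : R, is_derive z 1 f (df z)) ->
  (forall z, `|z - a| <= `|b - a| -> `|df z| <= M) -> `|f b - f a| <= M * `|b - a|.
Proof.
move=> fd dM.
have gd (z : R) : is_derive z 1 (fun z : R => M * z) M.
  exact: is_derive_mulr.
have [ab|/ltW ba] := leP a b.
  rewrite [ `|b - a| ]ger0_norm ?subr_ge0 // mulrBr.
  apply: (@derive_dominated R f df _ (fun=> M)) => // z /andP[az zb].
  by apply: dM; rewrite !ger0_norm ?subr_ge0 // lerD2r.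
rewrite distrC [ `|b - a| ]ler0_norm ?subr_le0 // opprB mulrBr.
apply: (@derive_dominated R f df _ (fun=> M)) => // z /andP[az zb].
by apply: dM; rewrite !ler0_norm ?subr_le0 // lerN2 lerD2r.
Qed.

Lemma taylor2_of_derive (f df ddf : R -> R) (a b M : R) :
  (forall z : R, is_derive z 1 f (df z)) -> (forall z : R, is_derive z 1 df (ddf z)) ->
  (forall z, `|ddf z| <= M) -> `|f b - f a - (b - a) * df a| <= (b - a) ^+ 2 * M.
Proof.
move=> fd dfd ddM; have M0 := le_trans (normr_ge0 _) (ddM 0).
have := @lipschitz_of_derive (fun z => f z - df a * z) (fun z => df z - df a) a b (M * `|b - a|).
rewrite (_ : f b - df a * b - _ = f b - f a - (b - a) * df a); last by ring.
rewrite (_ : M * _ * _ = (b - a) ^+ 2 * M); last first.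
  by rewrite -mulrA -expr2 real_normK ?num_real // mulrC.
apply.
- move=> z; apply: is_deriveB.
  exact: is_derive_mulr.
- move=> z za; apply: le_trans (lipschitz_of_derive dfd _) _ => //.
  by rewrite ler_wpM2l.
Qed.

(** The successive derivatives in [t] of [(1 - cos (s t)) / s ^ 2]. *)
Definition osc_deriv (s : R) (j : nat) (t : R) : R :=
  match j with
  | 0%N => (1 - cos (s * t)) / s ^+ 2
  | 1%N => sin (s * t) / s
  | i.+2 => s ^+ i * cos (s * t + i%:R * (pi / 2))
  end.

Lemma is_derive_osc (s : R) j (t : R) : s != 0 ->
  is_derive t 1 (osc_deriv s j) (osc_deriv s j.+1 t).
Proof.
move=> s0; have hs : is_derive t 1 (fun z : R => s * z) s.
  exact: is_derive_mulr.
case: j => [|[|j]] /=.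
- have h := @is_derive1_comp R _ _ t _ _ (is_derive_cos (s * t)) hs.
  have := is_deriveZ (s ^- 2) (is_deriveB (is_derive_cst (1 : R) t 1) h).
  rewrite (_ : _ \*: _ = fun z => (1 - cos (s * z)) / s ^+ 2); last first.
    by apply/funext => z /=; rewrite mulrC.
  by move=> /is_derive_eq; apply; rewrite /GRing.scale /=; field.
- have h := @is_derive1_comp R _ _ t _ _ (is_derive_sin (s * t)) hs.
  have := is_deriveZ (s^-1) h.
  rewrite (_ : _ \*: _ = fun z => sin (s * z) / s); last first.
    by apply/funext => z; rewrite [RHS]mulrC.
  by move=> /is_derive_eq; apply; rewrite /GRing.scale /= mul0r addr0 expr0 mul1r; field.
- have h1 : is_derive t 1 (fun z : R => s * z + j%:R * (pi / 2)) s.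
    have := is_deriveD hs (is_derive_cst (j%:R * (pi / 2) : R) t 1).
    by move=> /is_derive_eq; apply; rewrite addr0.
  have h := @is_derive1_comp R _ _ t _ _ (is_derive_cos (s * t + j%:R * (pi / 2))) h1.
  have := is_deriveZ (s ^+ j) h.
  move=> /is_derive_eq; apply; rewrite /GRing.scale /=.
  have -> : s * t + j.+1%:R * (pi / 2) = s * t + j%:R * (pi / 2) + pi / 2.
    by rewrite -[j.+1%:R]natr1; ring.
  by rewrite cosDpihalf exprS; ring.
Qed.

Lemma osc_le (s : R) j t : 0 < s -> `|osc_deriv s j.+2 t| <= (1 + s) ^+ j.
Proof.
move=> s0; rewrite /= normrM -[leRHS]mulr1 ler_pM ?cos_max //.
by rewrite normrX gtr0_norm // lerXn2r ?nnegrE ?addr_ge0 ?ltW // ltrDr.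
Qed.

Lemma osc_taylor (s : R) j a b : 0 < s ->
  `|osc_deriv s j b - osc_deriv s j a - (b - a) * osc_deriv s j.+1 a| <= (b - a) ^+ 2 * (1 + s) ^+ j.
Proof.
move=> s0; apply: (@taylor2_of_derive _ (osc_deriv s j.+1) (osc_deriv s j.+2)).
- by move=> z; apply: is_derive_osc; rewrite gt_eqF.
- by move=> z; apply: is_derive_osc; rewrite gt_eqF.
- by move=> z; exact: osc_le.
Qed.

(** For [j <= 1] the division by [s] is harmless although [s] has no positive
    lower bound: both functions vanish at [0], and the estimates come from their
    derivatives. *)
Lemma osc_bound (s : R) j t : 0 < s -> `|osc_deriv s j t| <= (1 + t ^+ 2) * (1 + s) ^+ j.
Proof.
move=> s0; have t2 := sqr_ge0 t.
have sj k : 1 <= (1 + s) ^+ k by rewrite exprn_ege1 // lerDl ltW.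
case: j => [|[|j]].
- have := osc_taylor 0 0 t s0.
  rewrite /= !mulr0 cos0 sin0 subrr !mul0r mulr0 !subr0 expr0 !mulr1; lra.
- have : `|osc_deriv s 1 t - osc_deriv s 1 0| <= 1 * `|t - 0|.
    apply: (@lipschitz_of_derive _ (osc_deriv s 2)) => z.
      by apply: is_derive_osc; rewrite gt_eqF.
    by move=> _; rewrite -(expr0 (1 + s)); exact: osc_le.
  rewrite /= mulr0 sin0 mul0r !subr0 mul1r => h; apply: le_trans h _.
  rewrite expr1; have := sqr_ge0 (`|t| - 1); rewrite sqrrB real_normK ?num_real //.
  by nra.
- apply: le_trans (osc_le _ _ s0) _.
  rewrite -[leLHS]mul1r ler_pM //; first by rewrite exprn_ge0 // addr_ge0 // ltW.
    by rewrite lerDl.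
  by rewrite -addn2 exprD ler_peMr // exprn_ge0 // addr_ge0 // ltW.
Qed.

End Oscillators.

(** * Sums over the lattice *)

Section LatticeSums.
Variable R : realType.

(** The bound telescopes: [1 / (1 + m ^ 2) <= 3 / (m + 1) - 3 / (m + 2)] amounts
    to [(2 m - 1) (m - 1) >= 0], true for every integer [m]. *)
Lemma sum_inv_1Dsqr (N : nat) :
  \sum_(m < N) (1 + m%:R ^+ 2)^-1 <= 3 - 3 / N.+1%:R :> R.
Proof.
elim: N => [|N IH]; first by rewrite big_ord0 divr1 subrr.
rewrite big_ord_recr /=; move: IH; rewrite -[N.+2%:R]natr1 -[N.+1%:R]natr1.
have N0 : 0 <= N%:R :> R by [].
have hN : 0 <= (2 * N%:R - 1) * (N%:R - 1) :> R.
  case: N N0 => [|N] _; first by rewrite !mulr0; lra.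
  by rewrite -natr1; have : 0 <= N%:R :> R by []; nra.
move: (N%:R) N0 hN => x x0 hx IH.
have h : (1 + x ^+ 2)^-1 <= 3 / (x + 1) - 3 / (x + 1 + 1).
  rewrite (_ : 3 / (x + 1) - _ = 3 / ((x + 1) * (x + 1 + 1))); last first.
    by field; rewrite !gt_eqF //; lra.
  rewrite ler_pdivlMr; last by nra.
  rewrite ler_pdivrMl; nra.
lra.
Qed.

(** Each absolute value is attained at most twice. *)
Lemma sum_int_inv_1Dsqr (s : seq int) : uniq s ->
  \sum_(v <- s) (1 + v%:~R ^+ 2)^-1 <= 6 :> R.
Proof.
move=> us; pose h (m : nat) : R := (1 + m%:R ^+ 2)^-1.
have h0 m : 0 <= h m by rewrite invr_ge0 addr_ge0 ?sqr_ge0.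
have [N hN] : exists N, forall v, v \in s -> (absz v < N)%N.
  exists (\max_(v <- s) absz v).+1 => v vs; rewrite ltnS.
  by rewrite (big_rem v vs) /= leq_maxl.
have -> : \sum_(v <- s) (1 + v%:~R ^+ 2)^-1 =
    \sum_(v <- s) \sum_(m < N | val m == absz v) h m.
  rewrite big_seq [RHS]big_seq; apply: eq_bigr => v vs.
  rewrite (big_pred1 (Ordinal (hN v vs))) //= /h.
  by rewrite natr_absz intr_norm real_normK // num_real.
rewrite (exchange_big_dep xpredT) //=; apply: (@le_trans _ _ (\sum_(m < N) h m *+ 2)).
  apply: ler_sum => m _; rewrite big_const_seq iter_addr_0 ler_wpMn2l //.
  rewrite -size_filter; apply: (@uniq_leq_size _ _ [:: Posz m; - Posz m]).
    exact: filter_uniq.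
  move=> v; rewrite mem_filter !inE => /andP[/eqP mv _].
  by rewrite mv; have [v0|v0] := leP 0 v; lia.
rewrite sumrMnl.
have : \sum_(m < N) h m <= 3 - 3 / N.+1%:R by exact: sum_inv_1Dsqr.
have : 0 <= 3 / N.+1%:R :> R by rewrite divr_ge0.
move=> h3 /(ler_wMn2r 2); move: h3; move: (3 / N.+1%:R : R) => x x0 hs.
by apply: le_trans hs _; lra.
Qed.

(** Each summand is at most the product of the [1 / (1 + k_i ^ 2)], and the sum of
    these products over a finite box is the [n]-th power of a one-dimensional
    sum. *)
Lemma sum_lattice n (s : seq 'cV[int]_n) : uniq s ->
  \sum_(k <- s) (1 + sqnorm (real_vec R k)) ^- n <= 6 ^+ n :> R.
Proof.
move=> us; pose g (v : int) : R := (1 + v%:~R ^+ 2)^-1.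
have g0 v : 0 <= g v by rewrite invr_ge0 addr_ge0 ?sqr_ge0.
pose L : seq int := 0 :: [seq (k : 'cV[int]_n) i 0 | k <- s, i <- enum 'I_n].
pose V : {fset int} := [fset v in L]%fset.
have V0 : 0 \in V by rewrite !inE.
have kV k i : k \in s -> k i 0 \in V.
  move=> ks; rewrite !inE; apply/orP; right.
  by apply/allpairsP; exists (k, i); rewrite mem_enum.
pose psi (k : 'cV[int]_n) : {ffun 'I_n -> V} := [ffun i => insubd [` V0]%fset (k i 0)].
have psiE k i : k \in s -> val (psi k i) = k i 0.
  by move=> ks; rewrite ffunE val_insubd kV.
apply: (@le_trans _ _ (\sum_(k <- s) \prod_i g (val (psi k i)))).
  rewrite big_seq [leRHS]big_seq; apply: ler_sum => k ks.
  rewrite -[X in _ ^- X](card_ord n) -prodr_const -prodfV; apply: ler_prod => i _.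
  have h : 1 + (k i 0)%:~R ^+ 2 <= 1 + sqnorm (real_vec R k).
    rewrite lerD2l /sqnorm (bigD1 i) //= mxE lerDl sumr_ge0 // => l _.
    exact: sqr_ge0.
  have p0 : 0 < 1 + (k i 0)%:~R ^+ 2 :> R by rewrite ltr_pwDl ?sqr_ge0.
  by rewrite psiE // /g invr_ge0 (le_trans (ltW p0) h) lef_pV2 // posrE (lt_le_trans p0 h).
have upsi : uniq (map psi s).
  rewrite map_inj_in_uniq // => k k' ks k's e.
  by apply/matrixP => i j; rewrite (ord1 j) -(psiE k i ks) e psiE.
rewrite -(big_map psi xpredT (fun f : {ffun 'I_n -> V} => \prod_i g (val (f i)))).
rewrite big_uniq //=.
apply: (@le_trans _ _ (\sum_(f : {ffun 'I_n -> V}) \prod_i g (val (f i)))).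
  rewrite big_mkcond; apply: ler_sum => f _; case: ifP => // _.
  by rewrite prodr_ge0.
rewrite -(bigA_distr_bigA (fun (i : 'I_n) (v : V) => g (val v))).
rewrite prodr_const card_ord lerXn2r ?nnegrE ?sumr_ge0 //.
by rewrite -(big_seq_fsetE _ V xpredT g) sum_int_inv_1Dsqr // fset_uniq.
Qed.

Lemma sobolev_bounded n (S : R) (b : periodic_dist R n) : b \in sobolev S ->
  exists M : R, forall s : seq 'cV[int]_n, uniq s ->
    \sum_(k <- s) (1 + sqnorm (real_vec R k)) `^ S * csqnorm (b k) <= M.
Proof.
rewrite inE /sobolev /=; set F := (fun k => _%:E) => hb.
have F0 : (0 <= \esum_(k in [set: 'cV[int]_n]) F k)%E.
  apply: esum_ge0 => k _; rewrite lee_fin mulr_ge0 ?powR_ge0 // sumr_ge0 // => i _.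
  by rewrite addr_ge0 ?sqr_ge0.
exists (fine (\esum_(k in [set: 'cV[int]_n]) F k)) => s us.
rewrite -lee_fin fineK ?ge0_fin_numE //; apply: esum_ge; exists [set` s].
  by split => //; exact: finite_seq.
by rewrite -fsbig_seq // sumEFin.
Qed.

End LatticeSums.

(** * Matrices with eigenspaces a line and its orthogonal complement *)

Section EigenMatrices.
Variables (R : realType) (n : nat).
Implicit Types (v : 'cV[R]_n) (a c : R).

Lemma eig_mx_comb v a c a' c' a'' c'' (r : R) :
  eig_mx v a c - eig_mx v a' c' - r *: eig_mx v a'' c'' =
  eig_mx v (a - a' - r * a'') (c - c' - r * c'').
Proof.
apply/matrixP => i j; rewrite !mxE; ring.
Qed.

Lemma eig_mx1 v : eig_mx v 1 1 = 1%:M.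
Proof. by rewrite /eig_mx !scale1r addrC subrK. Qed.

Lemma eig_mxM v a c a' c' : v != 0 ->
  eig_mx v a c *m eig_mx v a' c' = eig_mx v (a * a') (c * c').
Proof.
move=> v0; apply/(eig_mxP _ _ _ v0).
have [Av Aw] := (eig_mxP a c (eig_mx v a c) v0).1 erefl.
have [Av' Aw'] := (eig_mxP a' c' (eig_mx v a' c') v0).1 erefl.
split=> [|w vw]; first by rewrite -mulmxA Av' -scalemxAr Av scalerA mulrC.
by rewrite -mulmxA Aw' // -scalemxAr Aw // scalerA mulrC.
Qed.

Lemma invmx_eig v a c : v != 0 -> a != 0 -> c != 0 ->
  invmx (eig_mx v a c) = eig_mx v a^-1 c^-1.
Proof.
move=> v0 a0 c0; have h : eig_mx v a c *m eig_mx v a^-1 c^-1 = 1%:M.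
  by rewrite eig_mxM // !mulfV // eig_mx1.
have [u _] := mulmx1_unit h.
by rewrite -[LHS]mulmx1 -h mulKmx.
Qed.

Lemma eig_mx_entry v a c i j : `|eig_mx v a c i j| <= 2 * (`|a| + `|c|).
Proof.
rewrite /eig_mx !mxE big_ord1 !mxE.
set P := _^-1 * _; set d := (_%:R : R).
have sq l : v l 0 ^+ 2 <= sqnorm v.
  by rewrite /sqnorm (bigD1 l) //= lerDl sumr_ge0 // => m _; exact: sqr_ge0.
have P1 : `|P| <= 1.
  have [v0|v0] := eqVneq (sqnorm v) 0; first by rewrite /P v0 invr0 mul0r normr0.
  have vp : 0 < sqnorm v by rewrite lt0r v0 sumr_ge0 // => m _; exact: sqr_ge0.
  rewrite /P normrM normfV (gtr0_norm vp) ler_pdivrMl // mulr1 normrM.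
  have hi := sq i; have hj := sq j; have := sqr_ge0 (`|v i 0| - `|v j 0|).
  rewrite sqrrB !real_normK ?num_real //; lra.
have d1 : `|d| <= 1 by rewrite /d; case: (_ == _); rewrite ?normr1 ?normr0.
clearbody P d; apply: le_trans (ler_normD _ _) _; rewrite !normrM mulrDr; apply: lerD.
  by have := normr_ge0 a; nra.
rewrite [leRHS]mulrC ler_wpM2l // (le_trans (ler_normB _ _)) //.
by rewrite -[2]/(1 + 1 : R) lerD.
Qed.

End EigenMatrices.

(** * A single Fourier mode *)

Section Modes.
Local Open Scope complex_scope.
Variables (R : realType) (n : nat).
Local Notation V := ('cV[Cplx R]_n).

Definition l1norm (z : V) : R :=
  \sum_i Num.sqrt (complex.Re (z i 0) ^+ 2 + complex.Im (z i 0) ^+ 2).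

Lemma l1norm_ge0 (z : V) : 0 <= l1norm z.
Proof. by apply: sumr_ge0 => i _; exact: sqrtr_ge0. Qed.

Lemma norm_le_l1norm (z : V) : `|z| <= (l1norm z)%:C.
Proof.
apply: cV_norm_le => [|i]; first exact: l1norm_ge0.
rewrite normc_def lecR /l1norm (bigD1 i) //= lerDl sumr_ge0 //.
Qed.

(** One Fourier mode, as a function of the two eigenvalues [a] and [c] of the
    matrix applied to the coefficient [z].  It is linear in [(a, c)], which
    reduces all estimates on the modes to scalar ones. *)
Definition mode (theta : R) (v : 'cV[R]_n) (z : V) (a c : R) : V :=
  cis theta *: (map_mx (real_complex R) (eig_mx v a c) *m z).

Lemma mode_comb theta v z a c a' c' a'' c'' (r : R) :
  mode theta v z a c - mode theta v z a' c' - r%:C *: mode theta v z a'' c'' =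
  mode theta v z (a - a' - r * a'') (c - c' - r * c'').
Proof.
rewrite /mode -eig_mx_comb !map_mxB map_mxZ !mulmxBl -scalemxAl.
by rewrite !scalerBr !scalerA [r%:C * _]mulrC.
Qed.

Lemma norm_cis (theta : R) : `|cis theta| = 1.
Proof. by rewrite normc_def /= cos2Dsin2 sqrtr1. Qed.

Lemma mode_le theta v z a c :
  `|mode theta v z a c| <= (2 * (`|a| + `|c|) * l1norm z)%:C.
Proof.
apply: cV_norm_le => [|i].
  by rewrite mulr_ge0 ?l1norm_ge0 // mulr_ge0 // addr_ge0.
rewrite !mxE normrM norm_cis mul1r (le_trans (ler_norm_sum _ _ _)) //.
rewrite /l1norm mulr_sumr rmorph_sum; apply: ler_sum => l _.
rewrite normrM rmorphM /= -normc_def ler_wpM2r //.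
by rewrite mxE norm_real_complex lecR eig_mx_entry.
Qed.

(** Young's inequality [x y <= x ^ 2 / p + p y ^ 2] for each entry. *)
Lemma mul_l1norm_le (x p : R) (z : V) : 0 < p ->
  x * l1norm z <= n%:R * (x ^+ 2 / p) + p * csqnorm z.
Proof.
move=> p0; have -> : n%:R * (x ^+ 2 / p) = \sum_(i < n) x ^+ 2 / p.
  by rewrite sumr_const card_ord mulr_natl.
rewrite /l1norm /csqnorm !mulr_sumr -big_split /=; apply: ler_sum => i _.
set q := complex.Re _ ^+ 2 + _.
have q0 : 0 <= q by rewrite addr_ge0 ?sqr_ge0.
rewrite -[q in leRHS](sqr_sqrtr q0); move: (Num.sqrt q) => y.
have -> : x = (x / p) * p by rewrite divfK // gt_eqF.
move: (x / p) => w; rewrite exprMn expr2 expr2 -!mulrA divff ?gt_eqF // mulr1.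
have := sqr_ge0 (w - y); have := sqr_ge0 w; have := sqr_ge0 y.
rewrite -subr_ge0 => h1 h2 h3.
rewrite (_ : _ - _ = p * (w ^+ 2 - w * y + y ^+ 2)); last by ring.
by rewrite mulr_ge0 ?(ltW p0) //; move: h3; rewrite sqrrB; lra.
Qed.

End Modes.

(** * Summability of the coefficients against powers of the frequencies *)

Section Weights.
Local Open Scope complex_scope.
Variables (R : realType) (n : nat).
Local Notation W k := (1 + sqnorm (real_vec R k)).

Lemma weight_ge1 (k : 'cV[int]_n) : 1 <= W k.
Proof. by rewrite lerDl sqnorm_ge0. Qed.

Lemma real_vec_neq0 (k : 'cV[int]_n) : k != 0 -> real_vec R k != 0.
Proof.
apply: contraNneq => /matrixP h; apply/eqP/matrixP => i j; have := h i j.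
by rewrite !mxE => /eqP; rewrite intr_eq0 => /eqP.
Qed.

(** The hypothesis on [lam] is subpolynomial growth.  Its exponent [e] is chosen
    such that the square of [(1 + sqrt (- lam k)) ^ j] is
    [O(W k ^ (S - n))]. *)
Lemma weighted_sum_bounded (S : R) (b : periodic_dist R n) (lam : 'cV[int]_n -> R) (j : nat) :
  n%:R < S -> b \in sobolev S ->
  (forall e : R, 0 < e -> exists2 C : R, 0 <= C & forall k, `|lam k| <= C * W k `^ e) ->
  exists M : R, forall s : seq 'cV[int]_n, uniq s ->
    \sum_(k <- s) (1 + Num.sqrt (- lam k)) ^+ j * l1norm (b k) <= M.
Proof.
move=> nS hb hlam; pose e : R := (S - n%:R) / (2 * j)%N.+1%:R.
have e0 : 0 < e by rewrite divr_gt0 // subr_gt0.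
have [C C0 hC] := hlam e e0; have [M hM] := sobolev_bounded hb.
exists (n%:R * (2 + C) ^+ (2 * j) * 6 ^+ n + M) => s us.
apply: (@le_trans _ _ (\sum_(k <- s) (n%:R * (2 + C) ^+ (2 * j) * W k ^- n +
    W k `^ S * csqnorm (b k)))); last first.
  rewrite big_split /= lerD ?hM // -mulr_sumr ler_wpM2l ?sum_lattice //.
  by rewrite mulr_ge0 // exprn_ge0 // addr_ge0.
apply: ler_sum => k _; have W1 := weight_ge1 k; have W0 := lt_le_trans ltr01 W1.
have WS0 : 0 < W k `^ S by rewrite powR_gt0.
(* Young's inequality with weight p = W k ^ S *)
apply: le_trans (mul_l1norm_le _ (b k) WS0) _.
rewrite lerD2r -mulrA ler_wpM2l // ler_pdivrMr //.
have -> : (2 + C) ^+ (2 * j) * W k ^- n * W k `^ S = (2 + C) ^+ (2 * j) * W k `^ (S - n%:R).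
  by rewrite powRB ?gt_eqF ?implybT // powR_mulrn ?(ltW W0) // -mulrA [W k ^- n * _]mulrC.
have We : 1 <= W k `^ e by rewrite -[leLHS](powRr0 (W k)) ler_powR // ltW.
have h : 1 + Num.sqrt (- lam k) <= (2 + C) * W k `^ e.
  apply: (@le_trans _ _ (2 + `|lam k|)).
    have [l0|l0] := leP 0 (- lam k).
      have <- : Num.sqrt (- lam k) ^+ 2 = `|lam k| by rewrite sqr_sqrtr // -normrN ger0_norm.
      by move: (Num.sqrt _) => y; have := sqr_ge0 (y - 1); have := sqr_ge0 y; rewrite sqrrB; lra.
    by rewrite ltr0_sqrtr // addr0; have := normr_ge0 (lam k); lra.
  by rewrite mulrDl lerD // ler_peMr.
rewrite -exprM mulnC.
apply: (@le_trans _ _ (((2 + C) * W k `^ e) ^+ (2 * j))).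
  by rewrite lerXn2r ?nnegrE ?addr_ge0 ?sqrtr_ge0 ?mulr_ge0 ?powR_ge0 ?addr_ge0.
rewrite exprMn ler_wpM2l ?exprn_ge0 ?addr_ge0 //.
rewrite -powR_mulrn ?powR_ge0 // -powRrM ler_powR // /e mulrAC ler_pdivrMr //.
by rewrite ler_wpM2l ?subr_ge0 ?(ltW nS) // ler_nat.
Qed.

End Weights.

(** * The solution *)

Lemma comb_regroup (K : pzRingType) (V : lmodType K) (a b c r : K) (z f g h : V) :
  a *: z + f - (b *: z + g) - r *: (c *: z + h) =
  (a - b - r * c) *: z + (f - g - r *: h).
Proof.
rewrite !scalerBl scalerDr scalerA !opprD.
by rewrite [X in X + _ = _]addrACA [LHS]addrACA.
Qed.

Section Solution.
Local Open Scope complex_scope.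
Variables (R : realType) (n : nat) (delta beta mu lamstar : R).
Variable b : periodic_dist R n.
Hypothesis lam1 : forall nu : 'cV[R]_n, nu != 0 -> lambda1 delta beta mu lamstar nu < 0.
Hypothesis lam2 : forall nu : 'cV[R]_n, nu != 0 -> lambda2 delta beta mu nu < 0.

Local Notation I := {k : 'cV[int]_n | k != 0}.

Definition freq1 (k : 'cV[int]_n) : R :=
  Num.sqrt (- lambda1 delta beta mu lamstar (real_vec R k)).
Definition freq2 (k : 'cV[int]_n) : R :=
  Num.sqrt (- lambda2 delta beta mu (real_vec R k)).

Lemma freq1_gt0 (i : I) : 0 < freq1 (val i).
Proof. by rewrite sqrtr_gt0 oppr_gt0 lam1 // real_vec_neq0 // (valP i). Qed.

Lemma freq2_gt0 (i : I) : 0 < freq2 (val i).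
Proof. by rewrite sqrtr_gt0 oppr_gt0 lam2 // real_vec_neq0 // (valP i). Qed.

(** The [j]-th derivative in [t] of the summand of [u] of index [i]; see
    [u_termE] for [j = 0] and [u_term_deriv_taylor] for the induction. *)
Definition u_term_deriv (j : nat) (x : 'cV[R]_n) (t : R) (i : I) : 'cV[Cplx R]_n :=
  mode (dotp (real_vec R (val i)) x) (real_vec R (val i)) (b (val i))
    (osc_deriv (freq1 (val i)) j t) (osc_deriv (freq2 (val i)) j t).

Lemma u_termE x t : u_term delta beta mu lamstar b x t = u_term_deriv 0 x t.
Proof.
apply/funext => i; rewrite /u_term /u_term_deriv /mode; congr (_ *: (map_mx _ _ *m _)).
have v0 : real_vec R (val i) != 0 by rewrite real_vec_neq0 // (valP i).
have l1 := lam1 v0; have l2 := lam2 v0.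
rewrite /multiplier /cos_multiplier invmx_eig ?lt_eqF //.
rewrite -(eig_mx1 (real_vec R (val i))).
rewrite (_ : eig_mx _ _ _ - eig_mx _ 1 1 = eig_mx (real_vec R (val i))
  (cos (freq1 (val i) * t) - 1) (cos (freq2 (val i) * t) - 1)); last first.
  by apply/matrixP => a c; rewrite !mxE /freq1 /freq2; ring.
rewrite eig_mxM //; congr (eig_mx _ _ _).
  by rewrite /= sqr_sqrtr ?oppr_ge0 ?ltW // invrN mulrN -mulNr opprB.
by rewrite /= sqr_sqrtr ?oppr_ge0 ?ltW // invrN mulrN -mulNr opprB.
Qed.

Definition weight (j : nat) (i : I) : R :=
  2 * ((1 + freq1 (val i)) ^+ j + (1 + freq2 (val i)) ^+ j) * l1norm (b (val i)).

Lemma u_term_deriv_le j x t i : `|u_term_deriv j x t i| <= ((1 + t ^+ 2) * weight j i)%:C.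
Proof.
apply: le_trans (mode_le _ _ _ _ _) _; rewrite lecR /weight mulrA ler_wpM2r ?l1norm_ge0 //.
rewrite mulrCA ler_wpM2l // mulrDr.
by rewrite lerD // osc_bound // ?freq1_gt0 ?freq2_gt0.
Qed.

Lemma u_term_deriv_taylor j x s t i :
  `|u_term_deriv j x s i - u_term_deriv j x t i - (s - t)%:C *: u_term_deriv j.+1 x t i| <=
  ((s - t) ^+ 2 * weight j i)%:C.
Proof.
rewrite /u_term_deriv mode_comb; apply: le_trans (mode_le _ _ _ _ _) _.
rewrite lecR /weight mulrA ler_wpM2r ?l1norm_ge0 // mulrCA ler_wpM2l // mulrDr.
by rewrite lerD // osc_taylor // ?freq1_gt0 ?freq2_gt0.
Qed.

Variable S : R.
Hypotheses (n1 : (1 <= n)%N) (delta0 : 0 < delta) (betan : beta = n%:R).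
Hypotheses (nS : n%:R < S) (bS : b \in sobolev S).

Lemma weight_summable j : exists M : R, forall J : {fset I}, partial_sum (weight j) J <= M.
Proof.
have h1 (e : R) : 0 < e -> exists2 C : R, 0 <= C & forall k : 'cV[int]_n,
    `|lambda1 delta beta mu lamstar (real_vec R k)| <= C * (1 + sqnorm (real_vec R k)) `^ e.
  move=> e0; rewrite betan; have [C C0 hC] := lambda_subpolynomial mu lamstar n1 delta0 e0.
  by exists C => // k; have [] := hC (real_vec R k).
have h2 (e : R) : 0 < e -> exists2 C : R, 0 <= C & forall k : 'cV[int]_n,
    `|lambda2 delta beta mu (real_vec R k)| <= C * (1 + sqnorm (real_vec R k)) `^ e.
  move=> e0; rewrite betan; have [C C0 hC] := lambda_subpolynomial mu lamstar n1 delta0 e0.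
  by exists C => // k; have [] := hC (real_vec R k).
have [M1 hM1] := weighted_sum_bounded j nS bS h1.
have [M2 hM2] := weighted_sum_bounded j nS bS h2.
exists (2 * (M1 + M2)) => J; rewrite partial_sumE.
have uJ : uniq (map val J) by rewrite map_inj_uniq ?fset_uniq //; exact: val_inj.
have := lerD (hM1 _ uJ) (hM2 _ uJ); rewrite !big_map -big_split /= => h.
rewrite -(ler_pM2l (ltr0n R 2)) /= in h; apply: le_trans h; rewrite mulr_sumr.
by apply: ler_sum => i _; rewrite /weight -mulrDl mulrA.
Qed.

Lemma scaled_weight_summable j (c : R) : 0 <= c ->
  exists M : R, forall J : {fset I}, partial_sum (fun i => c * weight j i) J <= c * M.
Proof.
move=> c0; have [M hM] := weight_summable j; exists M => J.
by rewrite partial_sumE -mulr_sumr -partial_sumE ler_wpM2l.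
Qed.

Lemma cvg_u_term_deriv j x t : cvg (partial_sum (u_term_deriv j x t) @ totally).
Proof.
have t1 : 0 <= 1 + t ^+ 2 by rewrite addr_ge0 ?sqr_ge0.
have [M hM] := scaled_weight_summable j t1.
by apply: (cvg_family (u_term_deriv_le j x t) hM).
Qed.

(** The successive derivatives of [t ^ 2 / 2], the factor of the mode [0]. *)
Definition half_sqr_deriv (j : nat) (t : R) : R :=
  match j with 0%N => t ^+ 2 / 2 | 1%N => t | 2%N => 1 | _ => 0 end.

Lemma half_sqr_deriv_taylor j s t :
  `|half_sqr_deriv j s - half_sqr_deriv j t - (s - t) * half_sqr_deriv j.+1 t| <= (s - t) ^+ 2.
Proof.
have h := sqr_ge0 (s - t).
case: j => [|[|[|j]]] /=.
- rewrite (_ : _ - _ - _ = (s - t) ^+ 2 / 2); last by field.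
  by rewrite ger0_norm ?divr_ge0 // ; lra.
- by rewrite mulr1 subrr normr0.
- by rewrite subrr mulr0 subrr normr0.
- by rewrite subrr mulr0 subrr normr0.
Qed.

Lemma smooth_u x : smooth_ge0 (u delta beta mu lamstar b x).
Proof.
apply: (@smooth_of_quadratic R _
  (fun j t => (half_sqr_deriv j t)%:C *: b 0 + sum (u_term_deriv j x t))).
  by move=> t t0; rewrite /u u_termE.
move=> j; have [M hM] := weight_summable j.
exists (l1norm (b 0) + M) => s t _ _.
set X := (X in `|X| <= _).
set c := half_sqr_deriv j s - half_sqr_deriv j t - (s - t) * half_sqr_deriv j.+1 t.
have -> : X = c%:C *: b 0 + sum (fun i => u_term_deriv j x s i - u_term_deriv j x t i -
                                   (s - t)%:C *: u_term_deriv j.+1 x t i).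
  rewrite (sum_quotient _ (@cvg_u_term_deriv j x s) (@cvg_u_term_deriv j x t)
    (@cvg_u_term_deriv j.+1 x t)).
  have -> : c%:C = (half_sqr_deriv j s)%:C - (half_sqr_deriv j t)%:C -
      (s - t)%:C * (half_sqr_deriv j.+1 t)%:C :> R[i].
    rewrite /c (rmorphB _ (half_sqr_deriv j s - half_sqr_deriv j t)).
    by rewrite (rmorphB _ (half_sqr_deriv j s)) rmorphM.
  exact: comb_regroup.
apply: le_trans (ler_normD _ _) _.
rewrite [in leRHS]mulrDr [leRHS]rmorphD; apply: lerD.
  rewrite normrZ norm_real_complex [leRHS]rmorphM; apply: ler_pM => //.
  - by rewrite ler0c.
  - by rewrite lecR; exact: half_sqr_deriv_taylor.
  - exact: norm_le_l1norm.
apply: norm_sum_le (u_term_deriv_taylor j x s t) _ => J.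
by rewrite partial_sumE -mulr_sumr -partial_sumE ler_wpM2l ?sqr_ge0.
Qed.

End Solution.

Theorem theorem32 (R : realType) (n : nat) (delta beta mu lamstar S : R)
    (b : periodic_dist R n) :
  (1 <= n)%N ->
  0 < delta ->
  beta = n%:R ->
  0 < mu ->
  (forall nu : 'cV[R]_n, nu != 0 -> lambda1 delta beta mu lamstar nu < 0) ->
  (forall nu : 'cV[R]_n, nu != 0 -> lambda2 delta beta mu nu < 0) ->
  n%:R < S ->
  b \in sobolev S ->
  (forall x : 'cV[R]_n, torus x -> forall t : R, 0 <= t ->
     cvg (partial_sum (u_term delta beta mu lamstar b x t) @ totally)) /\
  (forall x : 'cV[R]_n, torus x -> smooth_ge0 (u delta beta mu lamstar b x)).
Proof.
move=> n1 delta0 betan _ lam1 lam2 nS bS; split=> x _.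
  by move=> t _; rewrite u_termE //; exact: (cvg_u_term_deriv _ _ n1 delta0 betan nS bS).
exact: (smooth_u _ _ n1 delta0 betan nS bS).
Qed.
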